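(* Let $m\ge2$ be an even integer. Suppose there exists an $\mathrm{OA}(\ell,r,s,r)_\lambda$ with symbols $0,1,\ldots,s-1$ and $s\ge m+1$. Suppose $A_1,\ldots,A_s,B_1,\ldots,B_s$ are rational numbers such that the $4s$ numbers $\pm A_1,\ldots,\pm A_s,\pm B_1,\ldots,\pm B_s$ are mutually distinct and (1) $[A_1,\ldots,A_s]=^s_m[B_1,\ldots,B_s]$, (2) $\sum_{i=1}^sA_i^{m+2}=\sum_{i=1}^sB_i^{m+2}$, (3) $\sum_{i=1}^sA_i=\sum_{i=1}^sB_i=0$. Let $X$ be the multiset of $2\ell$ vectors $\pm(A_{c_1+1},\ldots,A_{c_r+1})$, where $(c_1,\ldots,c_r)$ ranges over the rows of the orthogonal array, and let $Y$ be defined in the same way with $B$ in place of $A$. Then $(X,Y)$ is a proper $\mathrm{PTE}_r$ solution of degree $m+3$ and size $2\ell$.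
   Context: An orthogonal array $\mathrm{OA}(\ell,r,s,t)_\lambda$ is an $\ell\times r$ array with entries from a set of $s$ symbols such that in every $\ell\times t$ subarray each of the $s^t$ ordered $t$-tuples of symbols occurs as a row exactly $\lambda$ times. For multisets $A=\{\mathbf{a}_1,\ldots,\mathbf{a}_n\}$, $B=\{\mathbf{b}_1,\ldots,\mathbf{b}_n\}\subset\mathbb{Q}^r$ with $\mathbf{a}_i=(a_{i1},\ldots,a_{ir})$, $\mathbf{b}_i=(b_{i1},\ldots,b_{ir})$, $[A]=^n_m[B]$ (a $\mathrm{PTE}_r$ solution of degree $m$ and size $n$) means $A,B$ have no common element and $\sum_i\prod_j a_{ij}^{k_j}=\sum_i\prod_j b_{ij}^{k_j}$ for all nonnegative integers $k_j$ with $1\le\sum_jk_j\le m$; for $r=1$ this reads $\sum_i a_i^k=\sum_i b_i^k$ for $1\le k\le m$. A solution is proper if the $n\times r$ matrices with rows $\mathbf{a}_i$ resp. $\mathbf{b}_i$ both have rank $r$. *)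

(* Defs.v *)
From mathcomp Require Import all_boot all_order all_algebra.

Set Implicit Arguments.
Unset Strict Implicit.
Unset Printing Implicit Defensive.

Import GRing.Theory.
Local Open Scope ring_scope.

(* An l x t subarray keeps all rows and t of the columns in their original
   order, hence is given by a strictly increasing selection f of columns. *)
Definition orthogonal_array (l r s t lam : nat) (S : finType)
    (M : 'M[S]_(l, r)) : Prop :=
  #|S| = s /\
  forall f : 'I_t -> 'I_r, (forall i j : 'I_t, (i < j)%N -> (f i < f j)%N) ->
  forall w : 'rV[S]_t, #|[set i : 'I_l | row i (colsub f M) == w]| = lam.

(* A multiset of n vectors of Q^r is represented by the n x r matrix having
   these vectors as rows. *)
Definition PTE_solution (r n m : nat) (A B : 'M[rat]_(n, r)) : Prop :=
  (forall i j : 'I_n, row i A <> row j B) /\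
  forall k : 'I_r -> nat, (1 <= \sum_(j < r) k j <= m)%N ->
    \sum_(i < n) \prod_(j < r) A i j ^+ k j =
    \sum_(i < n) \prod_(j < r) B i j ^+ k j.

Definition proper_PTE_solution (r n m : nat) (A B : 'M[rat]_(n, r)) : Prop :=
  [/\ PTE_solution m A B, \rank A = r & \rank B = r].

(* Symbols and indices both start at 0, so that symbol c stands for the number
   usually written A_{c+1}. *)
Definition signed_rows (l r s : nat) (M : 'M['I_s]_(l, r)) (A : 'I_s -> rat) :
    'M[rat]_(l + l, r) :=
  col_mx (\matrix_(i < l, j < r) A (M i j)) (- \matrix_(i < l, j < r) A (M i j)).

(* Main.v *)
Require Import Defs.
From mathcomp Require Import all_boot all_order all_algebra.

Import GRing.Theory.
Local Open Scope ring_scope.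

(** An orthogonal array of full strength [r] lists every word of length [r]
    exactly [lam] times, so a monomial sum over its rows factors as [lam] times
    the product of the power sums [p_(k j)].  The sign change kills the monomials
    of odd degree.  In even degree at most [m + 2], each exponent either has
    equal power sums for [A] and [B], or is [m + 1]; in the latter case the
    degree is [m + 2], another exponent is [1], and both products vanish because
    [p_1 = 0].  The rank is full because two words differing in a single letter
    both occur as rows. *)

(** At full strength the identity is an admissible choice of columns. Words are finite functions
    here because distributing a product of sums gives a sum indexed by them. *)
Lemma orthogonal_array_word_count (l r lam : nat) (S : finType)
    (M : 'M[S]_(l, r)) :
  orthogonal_array #|S| r lam M ->
  forall w : {ffun 'I_r -> S}, #|[set i | [ffun j => M i j] == w]| = lam.
Proof.
case=> _ /(_ id (fun _ _ h => h)) HM w.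
rewrite -(HM (\row_j w j)); apply: eq_card => i; rewrite !inE.
apply/eqP/eqP => [<-|/rowP E]; first by apply/rowP => j; rewrite !mxE ffunE.
by apply/ffunP => j; have := E j; rewrite !mxE ffunE.
Qed.

Lemma orthogonal_array_word_row (l r lam : nat) (S : finType)
    (M : 'M[S]_(l, r)) :
  (0 < lam)%N -> orthogonal_array #|S| r lam M ->
  forall w : 'I_r -> S, exists i, forall j, M i j = w j.
Proof.
move=> lam0 /orthogonal_array_word_count HM w.
have /card_gt0P[i] : (0 < #|[set i | [ffun j => M i j] == finfun w]|)%N.
  by rewrite HM.
by rewrite inE => /eqP/ffunP E; exists i => j; have := E j; rewrite !ffunE.
Qed.

Lemma sum_prod_orthogonal_array (R : comNzRingType) (l r lam : nat)
    (S : finType) (M : 'M[S]_(l, r)) (F : 'I_r -> S -> R) :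
  orthogonal_array #|S| r lam M ->
  \sum_i \prod_j F j (M i j) = (\prod_j \sum_c F j c) *+ lam.
Proof.
move=> /orthogonal_array_word_count HM.
(* Distributing the product turns the right side into a sum over words; on the left the rows are
   grouped by the word they spell, each group having [lam] equal terms. *)
rewrite bigA_distr_bigA /= -sumrMnl.
rewrite (partition_big (fun i => [ffun j => M i j]) predT) //=.
apply: eq_bigr => w _.
rewrite -[in RHS](HM w) -sumr_const; apply: eq_big => [i|i /eqP <-].
  by rewrite inE.
by apply: eq_bigr => j _; rewrite ffunE.
Qed.

Lemma sum_prod_signed_rows (l r s : nat) (M : 'M['I_s]_(l, r))
    (A : 'I_s -> rat) (k : 'I_r -> nat) :
  \sum_i \prod_j signed_rows M A i j ^+ k j =
  (1 + (-1) ^+ (\sum_j k j)) * \sum_i \prod_j A (M i j) ^+ k j.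
Proof.
rewrite big_split_ord /= mulrDl mul1r; congr (_ + _).
  by apply: eq_bigr => i _; apply: eq_bigr => j _; rewrite col_mxEu mxE.
rewrite big_distrr /=; apply: eq_bigr => i _.
rewrite -prodrXr -big_split /=; apply: eq_bigr => j _.
by rewrite col_mxEd !mxE [LHS]exprNn.
Qed.

Lemma rank_signed_rows (l r s lam : nat) (M : 'M['I_s]_(l, r))
    (A : 'I_s -> rat) :
  (1 < s)%N -> injective A -> (0 < lam)%N ->
  orthogonal_array #|'I_s| r lam M -> \rank (signed_rows M A) = r.
Proof.
(* Full column rank is tested on a vector [v] orthogonal to every row, which must vanish. *)
move=> s1 injA lam0 HM; rewrite -mxrank_tr; apply/eqP/inj_row_free => v v0.
have val0 (w : 'I_r -> 'I_s) : \sum_j v 0 j * A (w j) = 0.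
  have [i Ei] := orthogonal_array_word_row _ _ _ _ _ lam0 HM w.
  move/rowP/(_ (lshift l i)): v0; rewrite !mxE => E; rewrite -[RHS]E.
  by apply: eq_bigr => j _; rewrite mxE col_mxEu mxE Ei.
apply/rowP => j; rewrite mxE.
pose c0 := Ordinal (ltnW s1); pose c1 := Ordinal s1.
(* This word and the constant word [c0] differ only at place [j]; subtracting their relations leaves
   [v 0 j * (A c1 - A c0) = 0]. *)
have := val0 (fun i => if i == j then c1 else c0).
rewrite -[RHS](val0 (fun=> c0)) (bigD1 j) //= eqxx [RHS](bigD1 j) //=.
rewrite (eq_bigr (fun i => v 0 i * A c0)) => [|i /negPf-> //].
move=> /addIr/eqP; rewrite -subr_eq0 -mulrBr mulf_eq0 => /orP[/eqP //|].
by rewrite subr_eq0 => /eqP/injA.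
Qed.

Lemma prod_power_sums_eq (R : comNzRingType) (r s m : nat) (A B : 'I_s -> R)
    (k : 'I_r -> nat) :
  ~~ odd m -> ~~ odd (\sum_j k j) -> (\sum_j k j <= m + 3)%N ->
  (forall n, (n <= m)%N -> \sum_i A i ^+ n = \sum_i B i ^+ n) ->
  \sum_i A i ^+ (m + 2) = \sum_i B i ^+ (m + 2) ->
  \sum_i A i = 0 -> \sum_i B i = 0 ->
  \prod_j \sum_i A i ^+ k j = \prod_j \sum_i B i ^+ k j.
Proof.
move=> em ek lek pAB pAB2 A0 B0.
(* Since [m] is even, [m + 3] is odd and parity excludes it. *)
have {}lek : (\sum_j k j <= m + 2)%N.
  move: lek; rewrite addnS leq_eqVlt => /orP[/eqP E|//].
  by move: ek; rewrite E /= oddD (negPf em).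
have [j0 /eqP kj0|kN] := pickP (fun j => k j == m + 1)%N; last first.
  apply: eq_bigr => j _; have [/pAB //|ltm] := leqP (k j) m.
  suff -> : k j = (m + 2)%N by [].
  have neq := kN j; rewrite addn1 in neq.
  apply/eqP; rewrite eqn_leq addn2 ltn_neqAle ltm eq_sym neq !andbT -addn2.
  by apply: leq_trans lek; rewrite (bigD1 j) //= leq_addr.
move: ek lek; rewrite (bigD1 j0) //= kj0 oddD oddD (negPf em) /= negbK => odk.
rewrite -addnA leq_add2l add1n ltnS => lek.
(* The exponents other than [k j0 = m + 1] have an odd sum that is at most 1. *)
have k1 : (\sum_(j | j != j0) k j = 1)%N.
  by apply/eqP; rewrite eqn_leq lek lt0n; case: eqP odk => // ->.
have [j1 j10 kj1] : exists2 j1, j1 != j0 & k j1 = 1%N.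
  have [j1 /andP[j10 kj1]|k0] := pickP (fun j => (j != j0) && (0 < k j)%N).
    exists j1 => //; apply/eqP; rewrite eqn_leq kj1 -k1.
    by rewrite (bigD1 j1) //= leq_addr.
  move: k1; rewrite big1 // => j jj0; apply/eqP.
  by have := k0 j; rewrite jj0 lt0n => /negbFE.
by rewrite (bigD1 j1) //= [RHS](bigD1 j1) //= kj1 A0 B0 !mul0r.
Qed.

Theorem theorem5p1 (m l r s lam : nat) (M : 'M['I_s]_(l, r))
    (A B : 'I_s -> rat)
    (hm : (2 <= m)%N) (hm_even : ~~ odd m)
    (hr : (1 <= r)%N) (hlam : (1 <= lam)%N)
    (hOA : @orthogonal_array l r s r lam 'I_s M)
    (hs : (m + 1 <= s)%N)
    (hdist : uniq (codom A ++ codom (fun i : 'I_s => - A i) ++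
                   codom B ++ codom (fun i : 'I_s => - B i)))
    (h1 : @PTE_solution 1 s m (\col_(i < s) A i) (\col_(i < s) B i))
    (h2 : \sum_(i < s) A i ^+ (m + 2) = \sum_(i < s) B i ^+ (m + 2))
    (h3 : \sum_(i < s) A i = 0 /\ \sum_(i < s) B i = 0) :
  @proper_PTE_solution r (l + l) (m + 3) (signed_rows M A) (signed_rows M B).
Proof.
have {}hOA : orthogonal_array #|'I_s| r lam M by rewrite card_ord.
have [A0 B0] := h3.
have pAB n : (n <= m)%N -> \sum_i A i ^+ n = \sum_i B i ^+ n.
  (* Exponent 0 lies outside the PTE condition, but both sums then count the [s] symbols. *)
  case: n => [|n] nm; first by apply: eq_bigr => i _; rewrite !expr0.
  have := h1.2 (fun=> n.+1); rewrite big_ord1 => /(_ nm) E.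
  transitivity (\sum_i \prod_(j < 1) (\col_i A i) i j ^+ n.+1).
    by apply: eq_bigr => i _; rewrite big_ord1 mxE.
  by rewrite E; apply: eq_bigr => i _; rewrite big_ord1 mxE.
have s1 : (1 < s)%N by apply: leq_trans hs; rewrite addn1 ltnS ltnW.
(* [uA] and [uB] provide the injectivity for the ranks; [dA] separates the values of [A] from those
   of [- A], [B] and [- B]. *)
move: hdist; rewrite !cat_uniq => /and3P[uA dA /and3P[_ dNA /and3P[uB _ _]]].
have AB c d : A c <> B d.
  move=> E; case/hasP: dA; exists (B d); last by rewrite -E codom_f.
  by rewrite !mem_cat codom_f orbT.
have ANB c d : A c <> - B d.
  move=> E; case/hasP: dA; exists (- B d); last by rewrite -E codom_f.
  by rewrite !mem_cat (codom_f (fun i => - B i)) !orbT.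
split; last 2 first.
- by apply: (rank_signed_rows _ _ _ lam) => //; apply/injectiveP.
- by apply: (rank_signed_rows _ _ _ lam) => //; apply/injectiveP.
split=> [i j /rowP/(_ (Ordinal hr))|k /andP[_ lek]].
  (* The first coordinate, present since [0 < r], already separates the rows; the cases are the four
     choices of signs. *)
  rewrite !mxE; case: split => i1; case: split => j1; rewrite !mxE.
  - exact: AB.
  - exact: ANB.
  - by move/(canRL opprK)/ANB.
  - by move/oppr_inj/AB.
rewrite !sum_prod_signed_rows.
have [ok|ek] := boolP (odd (\sum_j k j)).
  by rewrite -signr_odd ok expr1 subrr !mul0r.
rewrite !(sum_prod_orthogonal_array _ _ _ lam _ _ (fun j c => _ c ^+ k j)) //.
by rewrite (prod_power_sums_eq _ _ _ m A B).
Qed.
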